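(* Let $\phi=\phi_0\in W_0(L^1(\mathbb{R}^2))$, $a\in W(L^1(\mathbb{R}^2))$, and $\phi_j=a^j\star_c\phi$ for $j=1,\dots,m-1$. For $l,j\in\{0,1,\dots,m-1\}$ let $$\phi_l^j(r)=\phi_j(M^Tr-\eta_l)\,e^{i\pi(M^Tr-\eta_l)^TB^{-1}A(M^Tr-\eta_l)},\qquad r\in\mathbb{Z}^2 .$$ Then $L_{\mathcal{M}}\phi_l^j\in C(\mathbb{R}^2)$ for $l,j=0,1,\dots,m-1$. Let $\mathcal{B}(\xi)$ be the $m\times m$ matrix whose entry in row $j$ and column $l$ ($0\le j,l\le m-1$) is $(L_{\mathcal{M}}\phi_l^j)(\xi)$. Then any $f\in V(\phi)$ can be recovered in a stable way, i.e., the inverse of $\mathcal{B}(\xi)$ is bounded, from the dynamical sampling measurements $$f(M^Tk),\qquad (a^j\star_c f)(M^Tk),\quad j=1,2,\dots,m-1,\ k\in\mathbb{Z}^2,$$ if and only if $\det(\mathcal{B}(\xi))\neq0$ for any $\xi\in\mathbb{R}^2$.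
   Context: Let $A,B,C,D\in\mathbb{R}^{2\times2}$ with $B$ non-singular and $\mathcal{M}=[A,B;C,D]$ real symplectic, i.e. $AB^T=BA^T$, $CD^T=DC^T$, $AD^T-BC^T=I$. Let $\lambda_{\mathcal{M}}(t)=e^{i\pi t^TB^{-1}At}$; a bar denotes complex conjugation. $\sqrt{\det(iB)}$ is a fixed square root of $\det(iB)$. For a sequence $s$ on $\mathbb{Z}^2$, the two-dimensional discrete time non-separable linear canonical transform (2D-DT-NS-LCT) is $$(L_{\mathcal{M}}s)(\xi)=\frac{1}{\sqrt{\det(iB)}}\sum_{k\in\mathbb{Z}^2}s(k)e^{i\pi k^TB^{-1}Ak-2i\pi k^TB^{-1}\xi+i\pi\xi^TDB^{-1}\xi},\qquad \xi\in\mathbb{R}^2;$$ $L_{\mathcal{M}}\phi_l^j$ denotes this transform applied to the sequence $(\phi_l^j(r))_{r\in\mathbb{Z}^2}$. For functions $f,g$ on $\mathbb{R}^2$ the canonical convolution is $$(f\star_c g)(t)=\frac{\overline{\lambda}_{\mathcal{M}}(t)}{\sqrt{\det(iB)}}\int_{\mathbb{R}^2}\lambda_{\mathcal{M}}(t-x)f(t-x)\lambda_{\mathcal{M}}(x)g(x)\,dx,$$ and $a^j=a\star_c\cdots\star_c a$ ($j$ factors). For $s\in l^2(\mathbb{Z}^2)$ and $\phi\in L^2(\mathbb{R}^2)$, $$(s\star_{sd}\phi)(t)=\frac{\overline{\lambda}_{\mathcal{M}}(t)}{\sqrt{\det(iB)}}\sum_{k\in\mathbb{Z}^2}\lambda_{\mathcal{M}}(k)s(k)\lambda_{\mathcal{M}}(t-k)\phi(t-k),$$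 and the chirp-modulated shift-invariant space generated by $\phi$ is $V(\phi)=\overline{\{f\in L^2(\mathbb{R}^2): f=s\star_{sd}\phi,\ s\in l^2(\mathbb{Z}^2)\}}$ (closure in $L^2(\mathbb{R}^2)$). The Wiener amalgam space $W(L^1(\mathbb{R}^2))$ consists of the measurable $f$ with $\sum_{k\in\mathbb{Z}^2}\operatorname{ess\,sup}\{|f(x+k)| : x\in[0,1)^2\}<\infty$; $C(\mathbb{R}^2)$ is the space of continuous functions on $\mathbb{R}^2$; $W_0(L^1(\mathbb{R}^2))=W(L^1(\mathbb{R}^2))\cap C(\mathbb{R}^2)$. $M$ is a fixed $2\times2$ non-singular integer matrix, $m=|\det(M)|$, and $\eta_0=[0,0]^T,\eta_1,\dots,\eta_{m-1}$ are the $m$ distinct elements of $\mathcal{N}(M^T)=\{k\in\mathbb{Z}^2 : k=M^Tx,\ x\in[0,1)^2\}$. Stable recovery is, by definition, the condition that the inverse of $\mathcal{B}(\xi)$ is bounded: $\mathcal{B}(\xi)$ is invertible for every $\xi\in\mathbb{R}^2$ and $\xi\mapsto\mathcal{B}(\xi)^{-1}$ is bounded on $\mathbb{R}^2$. *)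

(* Defs.v *)
From HB Require Import structures.
From mathcomp Require Import all_boot all_order all_algebra complex.
From mathcomp Require Import all_classical all_reals all_analysis ess_sup_inf.
Set Implicit Arguments.
Unset Strict Implicit.
Unset Printing Implicit Defensive.
Import Order.TTheory GRing.Theory Num.Theory numFieldNormedType.Exports.
Local Open Scope classical_set_scope.
Local Open Scope ring_scope.
Local Open Scope complex_scope.

(* Functions on R^2 and sequences on Z^2 are defined on the column vectors
   'cV[R]_2 and 'cV[int]_2; the product measure lives on R * R and is
   transported along pt. *)
Definition pt (R : realType) (x : R * R) : 'cV[R]_2 :=
  \col_(i < 2) (if i == 0 then x.1 else x.2).

Definition leb2 (R : realType) :
    {measure set (measurableTypeR R * measurableTypeR R) -> \bar R} :=
  (@lebesgue_measure R \x @lebesgue_measure R)%E.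

Definition zvec (R : realType) (k : 'cV[int]_2) : 'cV[R]_2 := map_mx intr k.

Definition expi (R : realType) (x : R) : R[i] := cos x +i* sin x.

Definition bform (R : realType) (Q : 'M[R]_2) (u v : 'cV[R]_2) : R :=
  (u^T *m Q *m v) 0 0.

Definition borel_fun (R : realType) (f : 'cV[R]_2 -> R[i]) : Prop :=
  measurable_fun [set: measurableTypeR R * measurableTypeR R]
    (fun x => complex.Re (f (pt x))) /\
  measurable_fun [set: measurableTypeR R * measurableTypeR R]
    (fun x => complex.Im (f (pt x))).

(* Lebesgue measurability: measurable_fun alone refers to the Borel
   sigma-algebra of the plane. *)
Definition cmeasurable (R : realType) (f : 'cV[R]_2 -> R[i]) : Prop :=
  exists2 g : 'cV[R]_2 -> R[i], borel_fun g &
    {ae @leb2 R, forall x, f (pt x) = g (pt x)}.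

(* R[i]^o carries the topology of the complex modulus *)
Definition ccontinuous (R : realType) (f : 'cV[R]_2 -> R[i]) : Prop :=
  continuous (f : 'cV[R]_2 -> R[i]^o).

(* The library integral is defined for all functions as a supremum over Borel
   simple functions (for the positive and the negative part), so changing the
   integrand on a null set does not affect it even if the result is no longer
   Borel. *)
Definition cintegral (R : realType) (f : 'cV[R]_2 -> R[i]) : R[i] :=
  (\int[@leb2 R]_x complex.Re (f (pt x))) +i*
  (\int[@leb2 R]_x complex.Im (f (pt x))).

(* Unconditional summation over Z^2; meaningful for absolutely summable
   families, as are all those considered here. *)
Definition rsum (R : realType) (u : 'cV[int]_2 -> R) : R :=
  fine (\esum_(k in [set: 'cV[int]_2]) (EFin \o u)^\+ k -
        \esum_(k in [set: 'cV[int]_2]) (EFin \o u)^\- k)%E.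

Definition csum (R : realType) (s : 'cV[int]_2 -> R[i]) : R[i] :=
  rsum (fun k => complex.Re (s k)) +i* rsum (fun k => complex.Im (s k)).

Definition symplectic (R : realType) (A B C D : 'M[R]_2) : Prop :=
  [/\ A *m B^T = B *m A^T, C *m D^T = D *m C^T
    & A *m D^T - B *m C^T = 1%:M].

Definition is_sqrt_det_i (R : realType) (B : 'M[R]_2) (s : R[i]) : Prop :=
  s ^+ 2 = \det ('i%C *: map_mx (real_complex R) B).

Definition chirp (R : realType) (A B : 'M[R]_2) (t : 'cV[R]_2) : R[i] :=
  expi (pi * bform (invmx B *m A) t t).

Definition lct (R : realType) (A B D : 'M[R]_2) (sq : R[i])
    (s : 'cV[int]_2 -> R[i]) (xi : 'cV[R]_2) : R[i] :=
  sq^-1 * csum (fun k => s k *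
    expi (pi * bform (invmx B *m A) (zvec R k) (zvec R k)
          - 2 * pi * bform (invmx B) (zvec R k) xi
          + pi * bform (D *m invmx B) xi xi)).

Definition cconv (R : realType) (A B : 'M[R]_2) (sq : R[i])
    (f g : 'cV[R]_2 -> R[i]) (t : 'cV[R]_2) : R[i] :=
  (chirp A B t)^* / sq *
  cintegral (fun x => chirp A B (t - x) * f (t - x) * (chirp A B x * g x)).

(* j-fold canonical convolution power, for j >= 1 *)
Definition cpow (R : realType) (A B : 'M[R]_2) (sq : R[i])
    (a : 'cV[R]_2 -> R[i]) (j : nat) : 'cV[R]_2 -> R[i] :=
  iter j.-1 (cconv A B sq a) a.

Definition unit_square (R : realType) : set (R * R) :=
  `[0, 1[%classic `*` `[0, 1[%classic.

(* Extending |f(. + k)| by 0 outside the square does not change its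
   essential supremum over the square, since |f| >= 0. *)
Definition wiener (R : realType) (f : 'cV[R]_2 -> R[i]) : Prop :=
  cmeasurable f /\
  (\esum_(k in [set: 'cV[int]_2])
     ess_sup (@leb2 R)
       ((fun x => (complex.Re `|f (pt x + zvec R k)|)%:E) \_ (@unit_square R))
   < +oo)%E.

Definition wiener0 (R : realType) (f : 'cV[R]_2 -> R[i]) : Prop :=
  wiener f /\ ccontinuous f.

(* {k in Z^2 : k = Q x for some x in [0,1)^2} *)
Definition Nset (R : realType) (Q : 'M[int]_2) : set 'cV[int]_2 :=
  [set k | exists2 x : 'cV[R]_2, (forall i, 0 <= x i 0 < 1) &
           zvec R k = map_mx intr Q *m x].

Definition phi_ (R : realType) (A B : 'M[R]_2) (sq : R[i])
    (a phi : 'cV[R]_2 -> R[i]) (j : nat) : 'cV[R]_2 -> R[i] :=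
  if j is 0 then phi else cconv A B sq (cpow A B sq a j) phi.

(* the sequence phi_l^j, with e = eta_l *)
Definition phi_seq (R : realType) (A B : 'M[R]_2) (sq : R[i])
    (M : 'M[int]_2) (a phi : 'cV[R]_2 -> R[i]) (e : 'cV[int]_2) (j : nat)
    (r : 'cV[int]_2) : R[i] :=
  let t := zvec R (M^T *m r - e) in phi_ A B sq a phi j t * chirp A B t.

Definition samp_mx (R : realType) (A B D : 'M[R]_2) (sq : R[i])
    (M : 'M[int]_2) (a phi : 'cV[R]_2 -> R[i]) (m : nat)
    (eta : 'I_m -> 'cV[int]_2) (xi : 'cV[R]_2) : 'M[R[i]]_m :=
  \matrix_(j < m, l < m) lct A B D sq (phi_seq A B sq M a phi (eta l) j) xi.

(* Stable recovery of V(phi) from the dynamical samples is by definition this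
   condition on the matrix function samp_mx. *)
Definition stable_recovery (R : realType) (m : nat)
    (Bm : 'cV[R]_2 -> 'M[R[i]]_m) : Prop :=
  (forall xi, Bm xi \in unitmx) /\
  exists K : R, forall xi (i j : 'I_m), `|invmx (Bm xi) i j| <= K%:C.

(* Main.v *)
(* Writing cell(k) for the unit square with lower left corner k, a function in
   W(L^1) is dominated a.e. by a step function sum_k c(k) 1_cell(k) with c
   summable, and the canonical convolution of two such functions is dominated
   everywhere by another one, whose coefficients are a discrete convolution.
   Hence the values of every phi_j on Z^2 are absolutely summable (for
   phi_0 = phi this uses continuity), and L_M phi_l^j is continuous as a
   uniformly convergent series.  Translating xi by B n, n in Z^2, multiplies the
   matrix B(xi) by a unimodular scalar, so the moduli of the entries of its
   inverse are B Z^2-periodic; being continuous where the determinant does not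
   vanish, they are bounded on a fundamental domain, hence everywhere. *)
Require Import Defs.
From mathcomp Require Import all_boot all_order all_algebra complex.
From mathcomp Require Import ring lra.
From mathcomp Require Import all_classical all_reals all_analysis ess_sup_inf.
From mathcomp Require Import measurable_realfun.
Set Implicit Arguments.
Unset Strict Implicit.
Unset Printing Implicit Defensive.
Import Order.TTheory GRing.Theory Num.Theory numFieldNormedType.Exports.
Local Open Scope classical_set_scope.
Local Open Scope ring_scope.
Local Open Scope complex_scope.

(** The norm of [R[i]] takes values in [R[i]] itself; [cabs] is the modulus as an element of [R]. *)
Local Notation cabs := Normc.normc.

(** * Integration against Lebesgue measure of the plane *)

Section unmeasurable_integrand.
Local Open Scope ereal_scope.
Context d (T : measurableType d) (R : realType).
Variable mu : {measure set T -> \bar R}.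

Lemma ge0_le_integralT (f g : T -> \bar R) :
  (forall x, 0 <= f x) -> (forall x, f x <= g x) ->
  \int[mu]_x f x <= \int[mu]_x g x.
Proof.
move=> f0 fg.
have g0 x : 0 <= g x by exact: le_trans (fg x).
rewrite !ge0_integralTE//; apply: le_ereal_sup => _ [h /= hf <-].
by exists h => //= x; exact: le_trans (fg x).
Qed.

(* No measurability of h: the library integral of a nonnegative function is a
   supremum over simple functions below it, hence always monotone.  This spares
   us the measurability of the iterated convolutions. *)
Lemma ae_le_normr_Rintegral (h : T -> R) (g : T -> \bar R) :
  measurable_fun [set: T] g -> (forall x, 0 <= g x) ->
  {ae mu, forall x, `|h x|%:E <= g x} ->
  `|\int[mu]_x h x|%:E <= \int[mu]_x g x.
Proof.
move=> mg g0 [N [mN N0 hN]].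
(* Raising [g] to [+oo] on the null set [N] makes the domination hold everywhere and leaves the
   integral unchanged. *)
pose G x := if x \in N then +oo else g x.
have mG : measurable_fun [set: T] G.
  apply: measurable_fun_if => //.
  - apply: (measurable_fun_bool true).
    rewrite setTI (_ : _ @^-1` _ = N)//.
    by apply/seteqP; split=> x /=; [move/set_mem|move/mem_set].
  - exact: measurable_funS mg.
have G0 x : 0 <= G x by rewrite /G; case: ifP.
have iG : \int[mu]_x G x = \int[mu]_x g x.
  apply: ge0_ae_eq_integral => //; exists N; split => // x /= Gg.
  by apply: contrapT => xN; apply: Gg => _; rewrite /G memNset.
have hG x : `|h x|%:E <= G x.
  rewrite /G; case: ifPn => [_|]; first by rewrite leey.
  rewrite notin_setE => xN; apply: contrapT => hgx; apply: xN; exact: hN.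
rewrite /Rintegral integralE.
set p := (X in fine (X - _)); set n := (X in fine (_ - X)).
have p0 : 0 <= p by apply: integral_ge0.
have n0 : 0 <= n by apply: integral_ge0.
have pg : p <= \int[mu]_x g x.
  rewrite -iG; apply: ge0_le_integralT => // x; apply: le_trans (hG x).
  by rewrite funeposE/= ge_max !lee_fin ler_norm normr_ge0.
have ng : n <= \int[mu]_x g x.
  rewrite -iG; apply: ge0_le_integralT => // x; apply: le_trans (hG x).
  by rewrite funenegE/= ge_max !lee_fin -normrN ler_norm normr_ge0.
(* If the integral of [g] is [+oo], nothing is to be shown; otherwise [p] and [n] are finite and lie
   between 0 and it. *)
have : 0 <= \int[mu]_x g x by exact: le_trans pg.
move: p n p0 n0 pg ng; case: (\int[mu]_x g x) => [i||]//; last first.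
  by move=> *; rewrite leey.
move=> [p||]// [n||]//; rewrite !lee_fin => p0 n0 pi ni _.
rewrite ler_norml /=; apply/andP; split; lra.
Qed.
End unmeasurable_integrand.

(** * Reflection invariance of the Lebesgue measure *)

Lemma lebesgue_measure_reflection (R : realType) (t : R) (A : set R) :
  measurable A ->
  @lebesgue_measure R ((fun x => t - x) @^-1` A) = lebesgue_measure A.
Proof.
have mF : @measurable_fun _ _ (measurableTypeR R) (measurableTypeR R)
    [set: R] (fun x => t - x) by exact: measurable_funB.
pose F : {mfun measurableTypeR R >-> measurableTypeR R} :=
  @mfun_Sub _ _ _ (measurableTypeR R) _ (mem_set mF).
move=> mA; apply/esym.
apply: (@lebesgue_measure_unique _ (pushforward lebesgue_measure F)) => //.
move=> _ [[a b]] _ <-; rewrite /pushforward.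
(* The preimage of []a, b]] is closed on the left instead of the right; its length is the same. *)
rewrite [X in _ = lebesgue_measure X](_ : _ = `[t - b, t - a[%classic);
  last first.
  by apply/seteqP; split=> x /=; rewrite !in_itv/= => /andP[? ?];
    apply/andP; lra.
rewrite !lebesgue_measure_itv/= !lte_fin.
have -> : (t - b < t - a) = (a < b) by apply/idP/idP; lra.
by case: ifP => // _; congr (_%:E); lra.
Qed.

Lemma leb2X (R : realType) (X Y : set (measurableTypeR R)) :
  measurable X -> measurable Y ->
  leb2 R (X `*` Y) = (lebesgue_measure X * lebesgue_measure Y)%E.
Proof. exact: product_measure1E. Qed.

(** Preimages of rectangles are rectangles, so uniqueness of the product measure reduces this to the
    line. It carries almost everywhere bounds from [f] to [f (t - x)]. *)
Lemma leb2_reflection (R : realType) (t : R * R)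
    (A : set (measurableTypeR R * measurableTypeR R)) :
  measurable A ->
  leb2 R ((fun x => (t.1 - x.1, t.2 - x.2)) @^-1` A) = leb2 R A.
Proof.
have mF : @measurable_fun _ _ (measurableTypeR R * measurableTypeR R)%type
    (measurableTypeR R * measurableTypeR R)%type
    [set: R * R] (fun x => (t.1 - x.1, t.2 - x.2)).
  by apply/measurable_fun_pairP; split; apply: measurable_funB.
pose F : {mfun (measurableTypeR R * measurableTypeR R)%type
   >-> (measurableTypeR R * measurableTypeR R)%type} :=
  @mfun_Sub _ _ _ (measurableTypeR R * measurableTypeR R)%type _ (mem_set mF).
move=> mA; apply/esym.
apply: (@product_measure_unique _ _ _ _ _ (@lebesgue_measure R)
  (@lebesgue_measure R) (pushforward (leb2 R) F)) => //.
move=> X Y mX mY.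
have mS (r : R) (Z : set (measurableTypeR R)) : measurable Z ->
    measurable ((fun x => r - x) @^-1` Z : set (measurableTypeR R)).
  move=> mZ.
  have mr : @measurable_fun _ _ (measurableTypeR R) (measurableTypeR R)
    [set: R] (fun x => r - x) by exact: measurable_funB.
  by have := mr measurableT _ mZ; rewrite setTI.
transitivity (leb2 R (((fun x => t.1 - x) @^-1` X) `*`
                      ((fun x => t.2 - x) @^-1` Y))); first by [].
rewrite leb2X; [|exact: mS..].
by rewrite !lebesgue_measure_reflection.
Qed.

Lemma ae_leb2_reflection (R : realType) (t : R * R) (P : R * R -> Prop) :
  {ae leb2 R, forall x, P x} ->
  {ae leb2 R, forall x : R * R, P (t.1 - x.1, t.2 - x.2)}.
Proof.
move=> [N [mN N0 PN]].
exists ((fun x => (t.1 - x.1, t.2 - x.2)) @^-1` N); split.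
- have mF : @measurable_fun _ _ (measurableTypeR R * measurableTypeR R)%type
    (measurableTypeR R * measurableTypeR R)%type
    [set: R * R] (fun x => (t.1 - x.1, t.2 - x.2)).
    by apply/measurable_fun_pairP; split; apply: measurable_funB.
  by have := mF measurableT _ mN; rewrite setTI.
- by rewrite leb2_reflection.
- by move=> x /= /PN.
Qed.

(** * Unit cells and integrals of step functions *)

Definition floor2 (R : realType) (x : 'cV[R]_2) : 'cV[int]_2 :=
  map_mx Num.floor x.

(** With the cells as fibres of [floor2], a step function with values [c] on the cells is the
    composite of [c] and [floor2]. *)
Definition box (R : realType) (k : 'cV[int]_2) : set (R * R) :=
  [set x | floor2 (pt x) = k].
Arguments box : clear implicits.

Lemma boxE (R : realType) (k : 'cV[int]_2) : box R k =
  `[(k 0 0)%:~R, (k 0 0 + 1)%:~R[%classic `*`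
  `[(k 1 0)%:~R, (k 1 0 + 1)%:~R[%classic.
Proof.
apply/seteqP; split=> [x /= /matrixP xk|x [] /=].
  by split; rewrite /= in_itv /= -floor_eq -xk !mxE.
rewrite !in_itv/= -!floor_eq => /eqP x0 /eqP x1.
apply/matrixP => i j; rewrite (ord1 j) !mxE.
by case: i => [[|[|//]] ilt] /=; [rewrite x0|rewrite x1];
  congr (k _ _); apply: val_inj.
Qed.

Lemma measurable_box (R : realType) k : measurable
  (box R k : set (measurableTypeR R * measurableTypeR R)).
Proof. by rewrite boxE; apply: measurableX. Qed.

Lemma leb2_box (R : realType) k : leb2 R (box R k) = 1%E.
Proof.
rewrite boxE leb2X// !lebesgue_measure_itv/= !lte_fin.
rewrite !ltr_int !ltrDl ltr01 -!EFinB -!EFinM; congr (_%:E).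
rewrite !intrD; ring.
Qed.

Section integral_floor2.
Local Open Scope ereal_scope.
Variables (R : realType) (c : 'cV[int]_2 -> \bar R).
Hypothesis c0 : forall k, 0 <= c k.

(** The part of the step function on the cell with code [n]; a number that codes no vector
    contributes 0. *)
Let g (n : nat) (x : R * R) : \bar R :=
  oapp (fun k => c k * (\1_(box R k) x)%:E) 0 (pickle_inv n).

Let g0 n x : 0 <= g n x.
Proof. by rewrite /g; case: pickle_inv => //= k; apply: mule_ge0. Qed.

Let mg n : measurable_fun [set: measurableTypeR R * measurableTypeR R] (g n).
Proof.
rewrite /g; case: pickle_inv => [k|]/=; last exact: measurable_cst.
apply: measurable_funeM; apply/measurable_EFinP.
by apply: measurable_indic; exact: measurable_box.
Qed.

(** Only the code of the cell that contains [x] can give a nonzero term. *)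
Let gE x : c (floor2 (pt x)) = \sum_(n <oo) g n x.
Proof.
rewrite nneseries_esumT// (esumID [set pickle (floor2 (pt x))])// setTI.
rewrite esum_set1// esum1 ?adde0.
  by rewrite /g pickleK_inv/= indicE mem_set ?mule1.
move=> n [_ /= nx]; rewrite /g; have := @pickle_invK 'cV[int]_2 n.
case: (pickle_inv n) => [k|//] /= kn.
rewrite indicE memNset ?mule0// => xk; by apply: nx; rewrite xk kn.
Qed.

Lemma measurable_floor2 :
  measurable_fun [set: measurableTypeR R * measurableTypeR R]
    (fun x => c (floor2 (pt x))).
Proof.
rewrite (_ : (fun _ => _) = (fun x => \sum_(n <oo) g n x)).
  exact: ge0_emeasurable_sum.
by apply/funext => x; exact: gE.
Qed.

(** The series is integrated termwise, and each cell has area 1. Sums over the lattice thereby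
    inherit the theorems on integrals. *)
Lemma integral_floor2 :
  \int[leb2 R]_x c (floor2 (pt x)) = \esum_(k in setT) c k.
Proof.
under eq_integral do rewrite gE.
rewrite integral_nneseries// nneseries_esumT; last first.
  by move=> n; apply: integral_ge0.
have Ig n : \int[leb2 R]_x g n x = oapp c 0 (pickle_inv n).
  rewrite /g; case: pickle_inv => [k|]/=; last by rewrite integral0.
  rewrite ge0_integralZl//; last first.
    by apply/measurable_EFinP/measurable_indic; exact: measurable_box.
  by rewrite integral_indic//= ?setIT ?leb2_box ?mule1//; exact: measurable_box.
rewrite (eq_esum (fun n _ => Ig n)).
(* Terms outside the range of [pickle] vanish; on the range, injectivity allows reindexing by
   vectors. *)
transitivity (\esum_(n in range (@pickle 'cV[int]_2)) oapp c 0 (pickle_inv n)).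
  rewrite [RHS]esum_mkcond; apply: eq_esum => n _; case: ifPn => //.
  rewrite notin_setE => nr; have := @pickle_invK 'cV[int]_2 n.
  by case: (pickle_inv n) => [k /= kn|//]; case: nr; exists k.
rewrite esum_image; last by move=> k l _ _; exact: (pcan_inj pickleK_inv).
by apply: eq_esum => k _; rewrite pickleK_inv.
Qed.
End integral_floor2.

(** * Domination by step functions *)

Section complex_modulus.
Variable R : realType.
Implicit Types z : R[i].

Lemma cabsE z : cabs z = Num.sqrt (complex.Re z ^+ 2 + complex.Im z ^+ 2).
Proof. by case: z. Qed.

Lemma cabs_ge0 z : 0 <= cabs z.
Proof. by rewrite cabsE sqrtr_ge0. Qed.

Lemma normr_Re_le_cabs z : `|complex.Re z| <= cabs z.
Proof. by rewrite cabsE -sqrtr_sqr ler_wsqrtr// lerDl sqr_ge0. Qed.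

Lemma normr_Im_le_cabs z : `|complex.Im z| <= cabs z.
Proof. by rewrite cabsE -sqrtr_sqr ler_wsqrtr// lerDr sqr_ge0. Qed.

Lemma cabs_le_ReIm z : cabs z <= `|complex.Re z| + `|complex.Im z|.
Proof.
rewrite cabsE -(@ler_pXn2r _ 2)// ?nnegrE ?sqrtr_ge0 ?addr_ge0//.
rewrite sqr_sqrtr ?addr_ge0 ?sqr_ge0// sqrrD !real_normK ?num_real//.
by rewrite lerD2r lerDl mulrn_wge0 ?mulr_ge0.
Qed.

Lemma cabs_conj z : cabs z^* = cabs z.
Proof. by rewrite !cabsE; case: z => a b /=; rewrite sqrrN. Qed.

Lemma cabs_expi (x : R) : cabs (expi x) = 1.
Proof. by rewrite cabsE /= cos2Dsin2 sqrtr1. Qed.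

Lemma cabs_chirp (A B : 'M[R]_2) t : cabs (chirp A B t) = 1.
Proof. exact: cabs_expi. Qed.

End complex_modulus.

(** * Nonnegative sums over the integer lattice and discrete convolution *)

Section esum_lemmas.
Variable R : realType.
Local Open Scope ereal_scope.

(** Both sums are integrals of step functions, so this is homogeneity of the integral. *)
Lemma esumZl (c : 'cV[int]_2 -> \bar R) (r : \bar R) :
  (forall k, 0 <= c k) -> 0 <= r ->
  \esum_(k in setT) (r * c k) = r * \esum_(k in setT) c k.
Proof.
move=> c0 r0; rewrite -integral_floor2; last by move=> k; apply: mule_ge0.
by rewrite ge0_integralZl ?integral_floor2//; exact: measurable_floor2.
Qed.

Lemma esum_shift (c : 'cV[int]_2 -> \bar R) (q : 'cV[int]_2) :
  \esum_(k in setT) c (k - q)%R = \esum_(k in setT) c k.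
Proof.
rewrite [RHS](reindex_esum setT setT (fun k => k - q)%R)//; split=> //.
- by move=> x y _ _ /addIr.
- by move=> y _; exists (y + q)%R => //; rewrite addrK.
Qed.

Lemma exchange_esum (T T' : choiceType) (c : T -> T' -> \bar R) :
  (forall i j, 0 <= c i j) ->
  \esum_(i in setT) \esum_(j in setT) c i j =
  \esum_(j in setT) \esum_(i in setT) c i j.
Proof.
move=> c0; rewrite !esum_esum//.
rewrite (reindex_esum (setT `*`` (fun=> setT)) _ (fun x => (x.2, x.1)))//.
split=> //; first by move=> [? ?] [? ?] _ _ /= [-> ->].
by move=> [i j] _; exists (j, i).
Qed.

End esum_lemmas.

(* The vectors in {0, 1}^2, which are the possible values of
   floor x - floor y - floor (x - y). *)
Definition corner (i : bool * bool) : 'cV[int]_2 :=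
  \col_(j < 2) (if j == 0 then i.1%:Z else i.2%:Z).

Section discrete_convolution.
Variable R : realType.
Implicit Types c d : 'cV[int]_2 -> \bar R.
Local Open Scope ereal_scope.

(** A bound for [c] at the cell of a difference, which is known only up to one of four corners. *)
Definition corner_sum c (k : 'cV[int]_2) : \bar R :=
  \sum_(i : bool * bool) c (k - corner i)%R.

(** Up to a constant factor, the step function with these coefficients bounds the canonical
    convolution of functions dominated by [c] and [d]. *)
Definition corner_conv c d (k : 'cV[int]_2) : \bar R :=
  \esum_(l in setT) (corner_sum c (k - l)%R * d l).

Lemma corner_sum_ge0 c k : (forall k, 0 <= c k) -> 0 <= corner_sum c k.
Proof. by move=> c0; apply: sume_ge0. Qed.

Lemma corner_conv_ge0 c d k : (forall k, 0 <= c k) -> (forall k, 0 <= d k) ->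
  0 <= corner_conv c d k.
Proof.
by move=> c0 d0; apply: esum_ge0 => l _; rewrite mule_ge0 ?corner_sum_ge0.
Qed.

Lemma esum_corner_sum_lty c : (forall k, 0 <= c k) ->
  \esum_(k in setT) c k < +oo -> \esum_(k in setT) corner_sum c k < +oo.
Proof.
move=> c0 coo; rewrite esum_sum//.
under eq_bigr do rewrite esum_shift.
by apply: lte_sum_pinfty.
Qed.

(** After exchanging the sums, shift invariance turns the total into the product of the totals of
    [corner_sum c] and [d]. *)
Lemma esum_corner_conv_lty c d :
  (forall k, 0 <= c k) -> (forall k, 0 <= d k) ->
  \esum_(k in setT) c k < +oo -> \esum_(k in setT) d k < +oo ->
  \esum_(k in setT) corner_conv c d k < +oo.
Proof.
move=> c0 d0 coo doo; rewrite exchange_esum; last first.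
  by move=> i j; rewrite mule_ge0 ?corner_sum_ge0.
have E l : \esum_(k in setT) (corner_sum c (k - l)%R * d l) =
    (\esum_(k in setT) corner_sum c k) * d l.
  under eq_esum do rewrite muleC.
  by rewrite esumZl ?esum_shift 1?muleC// => k; exact: corner_sum_ge0.
rewrite (eq_esum (fun l _ => E l)).
have C0 : 0 <= \esum_(k in setT) corner_sum c k.
  by apply: esum_ge0 => k _; exact: corner_sum_ge0.
rewrite esumZl//; apply: lte_mul_pinfty => //.
by rewrite ge0_fin_numE// esum_corner_sum_lty.
Qed.

End discrete_convolution.

(** * Domination of amalgam functions and of their canonical convolutions *)

Section step_domination.
Variable R : realType.
Implicit Types (f g : 'cV[R]_2 -> R[i]) (c d : 'cV[int]_2 -> \bar R).
Local Open Scope ereal_scope.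

(** The fractional parts of [x] and [y] differ by a number in []-1, 1[]; [b] records whether it is
    negative. *)
Lemma floorB_cases (x y : R) : exists b : bool,
  (Num.floor (x - y) = Num.floor x - Num.floor y - b%:Z)%R.
Proof.
pose n := (Num.floor x - Num.floor y)%R.
have /andP[xl xu] := floor_itv x; have /andP[yl yu] := floor_itv y.
have [h|h] := leP n%:~R (x - y)%R; [exists false|exists true];
  apply: floor_def; rewrite ?subr0; move: h xl xu yl yu;
  rewrite /n !(intrD, intrB, mulr1z, rmorphN) /= => h xl xu yl yu;
  apply/andP; split; lra.
Qed.

Lemma floor2B_cases (x y : 'cV[R]_2) : exists i : bool * bool,
  (floor2 (x - y) = floor2 x - floor2 y - corner i)%R.
Proof.
have [b0 b0E] := floorB_cases (x 0%R 0%R) (y 0%R 0%R).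
have [b1 b1E] := floorB_cases (x 1%R 0%R) (y 1%R 0%R).
exists (b0, b1); apply/matrixP => i j; rewrite (ord1 j) !mxE /=.
case: i => [[|[|//]] ilt] /=.
- by rewrite (_ : Ordinal ilt = 0%R)//; exact: val_inj.
- by rewrite (_ : Ordinal ilt = 1%R)//; exact: val_inj.
Qed.

(** The summability condition of the amalgam space, in a form that canonical convolution
    preserves. *)
Definition step_dominated f :=
  exists c, [/\ forall k, 0 <= c k, \esum_(k in setT) c k < +oo &
    {ae leb2 R, forall x, (cabs (f (pt x)))%:E <= c (floor2 (pt x))}].

(** For the zero measure an essential supremum would be [-oo]; positivity makes those of [wiener]
    nonnegative. *)
Lemma leb2_setT_gt0 : 0 < leb2 R setT.
Proof.
apply: (@lt_le_trans _ _ (leb2 R (box R 0%R))).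
  by rewrite leb2_box lte01.
by apply: le_measure => //; rewrite inE//; exact: measurable_box.
Qed.

Lemma ae_leb2S2 (P Q S : R * R -> Prop) :
  (forall x, P x -> Q x -> S x) -> {ae leb2 R, forall x, P x} ->
  {ae leb2 R, forall x, Q x} -> {ae leb2 R, forall x, S x}.
Proof.
move=> PQS; apply: (filterS2 _ PQS).
exact: (@ae_filter_ringOfSetsType _ _ _ (leb2 R)).
Qed.

Lemma ae_leb2S (P Q : R * R -> Prop) : (forall x, P x -> Q x) ->
  {ae leb2 R, forall x, P x} -> {ae leb2 R, forall x, Q x}.
Proof. by move=> PQ aP; apply: (ae_leb2S2 _ aP aP) => x /PQ. Qed.

(** A translation is the composite of two reflections, [x -> t - x] and [x -> - x]. *)
Lemma ae_leb2_translation (t : R * R) (P : R * R -> Prop) :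
  {ae leb2 R, forall x, P x} ->
  {ae leb2 R, forall x : R * R, P (x.1 - t.1, x.2 - t.2)%R}.
Proof.
move=> /(ae_leb2_reflection (0, 0)%R)/(ae_leb2_reflection t).
by apply: ae_leb2S => x /=; rewrite !sub0r !opprB.
Qed.

Lemma ae_forall_countable disp (T : measurableType disp)
    (mu : {measure set T -> \bar R}) (I : countType) (P : I -> T -> Prop) :
  (forall i, {ae mu, forall x, P i x}) -> {ae mu, forall x i, P i x}.
Proof.
move=> aeP.
have : {ae mu, forall x n, oapp (P ^~ x) True (@pickle_inv I n)}.
  apply: ae_foralln => n; case: pickle_inv => [i|]/=; first exact: aeP.
  exact: aeW.
by apply: filterS => x Px i; have := Px (pickle i); rewrite pickleK_inv.
Qed.

(** The coefficients are the essential suprema over the cells. Moving each estimate from the unit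
    square to its cell leaves countably many null sets, whose union is null. *)
Lemma wiener_step_dominated f : wiener f -> step_dominated f.
Proof.
move=> [_ foo]; set c := (fun k => ess_sup _ _) in foo; exists c; split=> //.
  move=> k; apply: ess_sup_gee; first exact: leb2_setT_gt0.
  apply: aeW => x; apply: erestrict_ge0 => y _.
  by rewrite lee_fin; exact: cabs_ge0.
have : {ae leb2 R, forall x k, 
    ((fun y => (complex.Re `|f (pt y + zvec R k)|)%:E) \_ (@unit_square R))
      (x.1 - (k 0%R 0%R)%:~R, x.2 - (k 1%R 0%R)%:~R)%R <= c k}.
  apply: (@ae_forall_countable _ _ _ 'cV[int]_2
    (fun k x => (_ \_ (@unit_square R)) (_, _) <= c k)) => k.
  exact: (ae_leb2_translation ((k 0 0)%:~R, (k 1 0)%:~R)%R (ess_sup_ge _ _)).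
(* For [k] the cell of [x], the difference [x - k] lies in the unit square, where the extension by 0
   changes nothing. *)
apply: ae_leb2S => x /(_ (floor2 (pt x))); rewrite patchE mem_set; last first.
  rewrite /floor2 !mxE /=; split => /=; rewrite in_itv /=.
  - have := floor_itv x.1; rewrite intrD => /andP[? ?].
    by apply/andP; split; lra.
  - have := floor_itv x.2; rewrite intrD => /andP[? ?].
    by apply/andP; split; lra.
rewrite (_ : (pt _ + _)%R = pt x)//.
apply/matrixP => i j; rewrite (ord1 j) !mxE.
case: i => [[|[|//]] ilt] /=; rewrite subrK//.
Qed.

(** For almost every [x], with cell [l], the integrand has modulus at most
    [corner_sum c (floor2 t - l) * d l]; this step function has integral
    [corner_conv c d (floor2 t)]. The factor 2 comes from treating real and imaginary parts
    separately. *)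
Lemma cabs_cconv_le (A B : 'M[R]_2) sq f g c d :
  (forall k, 0 <= c k) -> (forall k, 0 <= d k) ->
  {ae leb2 R, forall x, (cabs (f (pt x)))%:E <= c (floor2 (pt x))} ->
  {ae leb2 R, forall x, (cabs (g (pt x)))%:E <= d (floor2 (pt x))} ->
  forall t, (cabs (cconv A B sq f g t))%:E <=
    (2 * cabs sq^-1)%:E * corner_conv c d (floor2 t).
Proof.
move=> c0 d0 fc gd t.
pose G k := corner_sum c (floor2 t - k)%R * d k.
have G0 k : 0 <= G k by rewrite mule_ge0 ?corner_sum_ge0.
have mG := measurable_floor2 G0.
have GE : \int[leb2 R]_x G (floor2 (pt x)) = corner_conv c d (floor2 t).
  exact: integral_floor2.
pose h x :=
  (chirp A B (t - pt x) * f (t - pt x) * (chirp A B (pt x) * g (pt x)))%R.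
have hG : {ae leb2 R, forall x, (cabs (h x))%:E <= G (floor2 (pt x))}.
  have := ae_leb2_reflection (t 0%R 0%R, t 1%R 0%R)%R fc.
  apply: (ae_leb2S2 _ gd) => x gx; set y := pt _ => fx.
  have -> : h x = (chirp A B y * f y * (chirp A B (pt x) * g (pt x)))%R.
    rewrite /h (_ : t - pt x = y)%R//; apply/matrixP => i j.
    rewrite (ord1 j) !mxE; case: i => [[|[|//]] ilt] /=; congr (t _ _ - _)%R.
    - exact: val_inj.
    - exact: val_inj.
  rewrite /h !Normc.normcM !cabs_chirp !mul1r EFinM.
  apply: lee_pmul => //; rewrite ?lee_fin ?cabs_ge0//.
  apply: (le_trans fx).
  have [i yi] := floor2B_cases t (pt x).
  have -> : floor2 y = (floor2 t - floor2 (pt x) - corner i)%R.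
    rewrite -yi; congr (floor2 _); apply/matrixP => k j.
    rewrite (ord1 j) !mxE; case: k => [[|[|//]] ilt] /=; congr (t _ _ - _)%R.
    - exact: val_inj.
    - exact: val_inj.
  by rewrite /corner_sum (bigD1 i)//= leeDl// sume_ge0.
have Goo : forall p : R[i] -> R, (forall z, `|p z| <= cabs z)%R ->
    `|\int[leb2 R]_x p (h x)|%:E <= corner_conv c d (floor2 t).
  move=> p pz; rewrite -GE; apply: ae_le_normr_Rintegral => //.
  by apply: ae_leb2S hG => x; apply: le_trans; rewrite lee_fin.
rewrite /cconv !Normc.normcM cabs_conj cabs_chirp mul1r EFinM.
rewrite muleC [in leRHS]EFinM muleAC [leRHS]muleC.
rewrite muleC; apply: lee_wpmul2l; first by rewrite lee_fin cabs_ge0.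
apply: (@le_trans _ _ (`|\int[leb2 R]_x complex.Re (h x)| +
    `|\int[leb2 R]_x complex.Im (h x)|)%:E).
  by rewrite lee_fin; exact: cabs_le_ReIm.
have -> : 2%:E = (1 + 1)%:E :> \bar R by [].
rewrite EFinD EFinD ge0_muleDl// mul1e; apply: leeD; apply: Goo.
- exact: normr_Re_le_cabs.
- exact: normr_Im_le_cabs.
Qed.

(** The bound holds at every [t], so that it can be evaluated on the integer lattice, a null set. *)
Lemma cconv_step_dominated (A B : 'M[R]_2) sq f g :
  step_dominated f -> step_dominated g ->
  exists c, [/\ forall k, 0 <= c k, \esum_(k in setT) c k < +oo &
    forall t, (cabs (cconv A B sq f g t))%:E <= c (floor2 t)].
Proof.
move=> [c [c0 coo fc]] [d [d0 doo gd]].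
have K0 : 0 <= (2 * cabs sq^-1)%:E :> \bar R.
  by rewrite lee_fin mulr_ge0 ?cabs_ge0.
exists (fun k => (2 * cabs sq^-1)%:E * corner_conv c d k); split.
- by move=> k; rewrite mule_ge0// corner_conv_ge0.
- rewrite esumZl//; last by move=> k; exact: corner_conv_ge0.
  apply: lte_mul_pinfty => //; exact: esum_corner_conv_lty.
- exact: cabs_cconv_le.
Qed.

Lemma cpow_step_dominated (A B : 'M[R]_2) sq a j :
  step_dominated a -> step_dominated (cpow A B sq a j).
Proof.
move=> ad; rewrite /cpow; elim: j.-1 => //= n IH.
have [c [c0 coo h]] := cconv_step_dominated A B sq ad IH.
by exists c; split => //; apply: aeW.
Qed.

(** A violation at [k] would by continuity extend to a small square with lower left corner [k],
    which lies in the cell of [k] and has positive area. *)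
Lemma le_step_zvec f c : ccontinuous f -> (forall k, 0 <= c k) ->
  {ae leb2 R, forall x, (cabs (f (pt x)))%:E <= c (floor2 (pt x))} ->
  forall k, (cabs (f (zvec R k)))%:E <= c k.
Proof.
move=> fcont c0 fc k; rewrite leNgt; apply/negP => ck.
have : \forall y \near zvec R k, c k < (cabs (f y))%:E.
  have ckfin : c k \is a fin_num by rewrite ge0_fin_numE// (lt_trans ck) ?ltry.
  have := fcont (zvec R k).
  rewrite -(fineK ckfin) lte_fin in ck *.
  pose e := (cabs (f (zvec R k)) - fine (c k))%R.
  have e0 : (0 < e%:C)%R by rewrite ltcR subr_gt0.
  move=> /cvgrPdist_lt/(_ _ e0); apply: filterS => y.
  move=> fy; rewrite lte_fin.
  have {}fy : (cabs (f (zvec R k) - f y)%R < e)%R by rewrite -ltcR.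
  have := le_normcD (f (zvec R k) - f y)%R (f y); rewrite subrK.
  move: fy; rewrite /e; lra.
move=> /nbhs_ballP[e /= e0 ke].
(* The bound [e] keeps the square inside the ball where the estimate fails, the bound 1 keeps it
   inside the cell. *)
pose r := Num.min e 1%R; have r0 : (0 < r)%R by rewrite lt_min e0 ltr01.
have re : (r <= e)%R by rewrite ge_min lexx.
have r1 : (r <= 1)%R by rewrite ge_min lexx orbT.
pose S := (`[(k 0 0)%:~R, (k 0 0)%:~R + r[%classic `*`
  `[(k 1 0)%:~R, (k 1 0)%:~R + r[%classic : set (R * R))%R.
have mS : measurable (S : set (measurableTypeR R * measurableTypeR R)).
  exact: measurableX.
have S0 : leb2 R S = (r * r)%:E.
  rewrite leb2X// !lebesgue_measure_itv/= !lte_fin !ltrDl r0 -!EFinB -!EFinM.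
  by rewrite !(addrC _ r) !addrK.
have Sf : {ae leb2 R, forall x, ~ S x}.
  apply: ae_leb2S fc => x fx [/=]; rewrite !in_itv/=.
  move=> /andP[x1l x1u] /andP[x2l x2u].
  have : c k < (cabs (f (pt x)))%:E.
    apply: ke; split => // i j; rewrite (ord1 j) !mxE /= /ball/= ltr_norml.
    case: i => [[|[|//]] ilt] /=.
    - by rewrite (_ : Ordinal ilt = 0%R) ?lerD//; [lra|exact: val_inj].
    - by rewrite (_ : Ordinal ilt = 1%R) ?lerD//; [lra|exact: val_inj].
  rewrite ltNge => /negP; apply; rewrite (_ : k = floor2 (pt x))//.
  suff : box R k x by [].
  rewrite boxE; split => /=; rewrite in_itv/= intrD.
  - by rewrite x1l/= (lt_le_trans x1u)// lerD2l.
  - by rewrite x2l/= (lt_le_trans x2u)// lerD2l.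
have /eqP : leb2 R S = 0%R.
  apply: measure_negligible => //.
  by apply: negligibleS Sf => x Sx /=; exact.
rewrite S0 eqe mulf_eq0 orbb.
by rewrite gt_eqF.
Qed.

End step_domination.

(** * Summability of the sampled sequences *)

Lemma esum_subset_image (R : realType) (T T' : choiceType) (e : T -> T')
    (c : T' -> \bar R) : injective e -> (forall k, 0 <= c k)%E ->
  (\esum_(k in setT) c (e k) <= \esum_(k in setT) c k)%E.
Proof.
move=> einj c0; rewrite -(@esum_image _ _ _ setT e)//; last first.
  by move=> ? ? _ _ /einj.
by rewrite esum_mkcond; apply: le_esum => k _; case: ifP.
Qed.

(** An integer matrix with nonzero determinant may have no integer inverse; its adjugate reduces the
    claim to cancelling the scalar [\det M]. *)
Lemma mulmx_det_neq0_inj (F : idomainType) n (M : 'M[F]_n) : \det M != 0 ->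
  injective (mulmx M : 'cV_n -> 'cV_n).
Proof.
move=> M0 x y /(congr1 (mulmx (\adj M))).
rewrite !mulmxA mul_adj_mx !mul_scalar_mx => xy.
apply/matrixP => i j; have /matrixP/(_ i j) := xy.
by rewrite !mxE => /(mulfI M0).
Qed.

(** The values on the lattice are dominated by a summable [c], the chirp has modulus 1, and distinct
    [r] give distinct sampling points. *)
Lemma phi_seq_summable (R : realType) (A B : 'M[R]_2) (sq : R[i])
    (M : 'M[int]_2) (phi a : 'cV[R]_2 -> R[i]) (e : 'cV[int]_2) (j : nat) :
  \det M != 0 -> wiener0 phi -> wiener a ->
  (\esum_(r in setT) (cabs (phi_seq A B sq M a phi e j r))%:E < +oo)%E.
Proof.
move=> M0 [/wiener_step_dominated phid phic] /wiener_step_dominated ad.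
have [c [c0 coo phijc]] : exists c : 'cV[int]_2 -> \bar R,
  [/\ forall k, (0 <= c k)%E, (\esum_(k in setT) c k < +oo)%E &
    forall k, ((cabs (phi_ A B sq a phi j (zvec R k)))%:E <= c k)%E].
  case: j => [|j] /=.
    (* For [j = 0] continuity carries the almost everywhere bound to the lattice; for larger [j] the
       convolution is bounded everywhere. *)
    have [c [c0 coo phic']] := phid.
    by exists c; split=> //; exact: le_step_zvec.
  have aj := cpow_step_dominated A B sq j.+1 ad.
  have [c [c0 coo h]] := cconv_step_dominated A B sq aj phid.
  exists c; split=> // k; apply: (le_trans (h _)).
  suff -> : floor2 (zvec R k) = k by [].
  by apply/matrixP => u v; rewrite !mxE intrKfloor.
apply: (le_lt_trans _ coo).
apply: (@le_trans _ _ (\esum_(r in setT) c (M^T *m r - e))).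
  by apply: le_esum => r _; rewrite /phi_seq Normc.normcM cabs_chirp mulr1.
apply: esum_subset_image => // x y /addIr; apply: mulmx_det_neq0_inj.
by rewrite det_tr.
Qed.

(** * The discrete canonical transform of a summable sequence *)

Section sums.
Variable R : realType.
Implicit Types (u v : 'cV[int]_2 -> R) (s : 'cV[int]_2 -> R[i]).

(** Makes linearity of the integral available for signed sums. *)
Lemma rsumE u : rsum u = \int[leb2 R]_x u (floor2 (pt x)).
Proof.
rewrite /rsum /Rintegral integralE; congr (fine (_ - _)).
- rewrite -(@integral_floor2 R ((EFin \o u)^\+)%E); last first.
    by move=> k; exact: funepos_ge0.
  by apply: eq_integral => x _; rewrite !funeposE.
- rewrite -(@integral_floor2 R ((EFin \o u)^\-)%E); last first.
    by move=> k; exact: funeneg_ge0.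
  by apply: eq_integral => x _; rewrite !funenegE.
Qed.

Lemma integrable_floor2_real u : (\esum_(k in setT) `|u k|%:E < +oo)%E ->
  (leb2 R).-integrable [set: measurableTypeR R * measurableTypeR R]
    (fun x => (u (floor2 (pt x)))%:E).
Proof.
move=> uoo; apply/integrableP; split.
  have mp := @measurable_floor2 R (fun k => ((EFin \o u)^\+)%E k)
    (fun k => funepos_ge0 _ _).
  have mn := @measurable_floor2 R (fun k => ((EFin \o u)^\-)%E k)
    (fun k => funeneg_ge0 _ _).
  rewrite (_ : (fun _ => _) = (fun x => (EFin \o u)^\+ (floor2 (pt x)) -
      (EFin \o u)^\- (floor2 (pt x))))%E.
    exact: emeasurable_funB.
  apply/funext => x.
  by have /(congr1 (fun g => g (floor2 (pt x)))) := funeposneg (EFin \o u).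
by rewrite (@integral_floor2 _ (fun k => `|u k|%:E)).
Qed.

Definition csummable s := (\esum_(k in setT) (cabs (s k))%:E < +oo)%E.

Lemma csummable_le s (b : 'cV[int]_2 -> R) :
  (forall k, cabs (s k) <= b k) -> (\esum_(k in setT) (b k)%:E < +oo)%E ->
  csummable s.
Proof.
by move=> sb; apply: le_lt_trans; apply: le_esum => k _; rewrite lee_fin.
Qed.

Lemma csummable_Re s : csummable s ->
  (\esum_(k in setT) `|complex.Re (s k)|%:E < +oo)%E.
Proof.
by apply: le_lt_trans; apply: le_esum => k _; rewrite lee_fin normr_Re_le_cabs.
Qed.

Lemma csummable_Im s : csummable s ->
  (\esum_(k in setT) `|complex.Im (s k)|%:E < +oo)%E.
Proof.
by apply: le_lt_trans; apply: le_esum => k _; rewrite lee_fin normr_Im_le_cabs.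
Qed.

Lemma rsum_norm_le u : (`|rsum u|%:E <= \esum_(k in setT) `|u k|%:E)%E.
Proof.
rewrite rsumE -[leRHS](@integral_floor2 R (fun k => `|u k|%:E))//.
apply: ae_le_normr_Rintegral => //; last exact: aeW.
exact: (@measurable_floor2 R (fun k => `|u k|%:E)).
Qed.

Lemma csumZ (w : R[i]) s : csummable s -> csum (fun k => w * s k) = w * csum s.
Proof.
move=> soo; have iR := integrable_floor2_real (csummable_Re soo).
have iI := integrable_floor2_real (csummable_Im soo).
rewrite /csum !rsumE; case: w => a b.
rewrite (_ : (fun x => _) = (fun x => a * complex.Re (s (floor2 (pt x)))
    - b * complex.Im (s (floor2 (pt x))))); last first.
  by apply/funext => x; case: (s _).
rewrite (_ : (fun x : R * R => complex.Im _) =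
  (fun x => a * complex.Im (s (floor2 (pt x)))
    + b * complex.Re (s (floor2 (pt x))))); last first.
  by apply/funext => x; case: (s _) => ? ?.
have iZ r (u : R * R -> R) :
    (leb2 R).-integrable [set: measurableTypeR R * measurableTypeR R]
      (fun x => (u x)%:E) ->
    (leb2 R).-integrable [set: measurableTypeR R * measurableTypeR R]
      (EFin \o (fun x => r * u x)).
  by move=> iu; have := integrableZl measurableT r iu.
by rewrite RintegralB ?RintegralD ?RintegralZl//; exact: iZ.
Qed.

Lemma csumB s s' : csummable s -> csummable s' ->
  csum (fun k => s k - s' k) = csum s - csum s'.
Proof.
move=> soo s'oo; have iR := integrable_floor2_real (csummable_Re soo).
have iI := integrable_floor2_real (csummable_Im soo).
have iR' := integrable_floor2_real (csummable_Re s'oo).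
have iI' := integrable_floor2_real (csummable_Im s'oo).
rewrite /csum !rsumE.
rewrite (_ : (fun x => _) = (fun x => complex.Re (s (floor2 (pt x)))
    - complex.Re (s' (floor2 (pt x))))); last first.
  by apply/funext => x; case: (s _) (s' _) => ? ? [].
rewrite (_ : (fun x : R * R => complex.Im _) =
  (fun x => complex.Im (s (floor2 (pt x)))
    - complex.Im (s' (floor2 (pt x))))); last first.
  by apply/funext => x; case: (s _) (s' _) => ? ? [].
by rewrite !RintegralB.
Qed.

(** The crude factor 2, from adding the bounds for real and imaginary parts, is harmless for
    continuity. *)
Lemma cabs_csum_le s :
  ((cabs (csum s))%:E <= 2%:E * \esum_(k in setT) (cabs (s k))%:E)%E.
Proof.
apply: (@le_trans _ _ (`|rsum (fun k => complex.Re (s k))| +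
    `|rsum (fun k => complex.Im (s k))|)%:E).
  by rewrite lee_fin; exact: cabs_le_ReIm.
have -> : 2%:E = (1 + 1)%:E :> \bar R by [].
rewrite EFinD EFinD ge0_muleDl// mul1e; apply: leeD.
- apply: (le_trans (rsum_norm_le _)); apply: le_esum => k _.
  by rewrite lee_fin normr_Re_le_cabs.
- apply: (le_trans (rsum_norm_le _)); apply: le_esum => k _.
  by rewrite lee_fin normr_Im_le_cabs.
Qed.

(** The sum is a supremum of finite sums; [F] is a finite set whose sum comes within [e] of it. *)
Lemma esum_tail_lt (b : 'cV[int]_2 -> \bar R) (e : R) :
  (forall k, 0 <= b k)%E ->
  (\esum_(k in setT) b k < +oo)%E -> 0 < e ->
  exists2 F : set 'cV[int]_2, finite_set F & (\esum_(k in ~` F) b k < e%:E)%E.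
Proof.
move=> b0 boo e0.
have bfin : (\esum_(k in setT) b k)%E \is a fin_num.
  by rewrite ge0_fin_numE// esum_ge0.
have [_ [F [finF _] <-]] := ub_ereal_sup_adherent e0 bfin.
rewrite -/(esum setT b) => bF; exists F => //.
move: bF; rewrite -esum_fset//; move: bfin.
rewrite (esumID F)// !setTI => /[dup] bfin.
rewrite fin_numD => /andP[].
case: (\esum_(k in F) b k)%E => // p; case: (\esum_(k in ~` F) b k)%E => // q.
by move=> _ _; rewrite -!(EFinD, EFinN) !lte_fin; lra.
Qed.

Lemma cvg_cabsP (T : topologicalType) (f : T -> R[i]^o) (x0 : T) (l : R[i]^o) :
  (f x @[x --> x0] --> l) <->
  (forall e : R, 0 < e -> \forall x \near x0, cabs (l - f x) < e).
Proof.
split=> [/cvgrPdist_lt fl e e0|fl].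
  have e0' : 0 < e%:C by rewrite ltcR.
  by apply: filterS (fl _ e0') => x; rewrite ltcR.
(* A positive element of [R[i]] has imaginary part 0, so real tolerances suffice. *)
apply/cvgrPdist_lt => e; rewrite ltcE => /andP[/eqP/= eI eR].
by apply: filterS (fl _ eR) => x; rewrite ltcE/= eI eqxx.
Qed.

(** Weierstrass test: termwise convergence handles a finite set of indices, and the majorant [b]
    controls the rest uniformly. *)
Lemma cvg_csum (T : topologicalType) (u : T -> 'cV[int]_2 -> R[i])
    (b : 'cV[int]_2 -> R) (x0 : T) :
  (forall x k, cabs (u x k) <= b k) -> (\esum_(k in setT) (b k)%:E < +oo)%E ->
  (forall k, u x k @[x --> x0] --> (u x0 k : R[i]^o)) ->
  csum (u x) @[x --> x0] --> (csum (u x0) : R[i]^o).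
Proof.
move=> ub boo uc; apply/cvg_cabsP => e e0.
have b0 k : (0 <= (b k)%:E)%E.
  by rewrite lee_fin (le_trans (cabs_ge0 _) (ub x0 k)).
(* The differences are at most [2 * b k], so the tail contributes at most [e / 4]; with less than
   [e / 4] from [F] and the factor 2 of [cabs_csum_le], the total stays below [e]. *)
have e80 : 0 < e / 8 by rewrite divr_gt0.
have [F finF Fb] := esum_tail_lt b0 boo e80.
have su x : csummable (u x) by exact: csummable_le (ub x) boo.
have near_sum (r : seq 'cV[int]_2) (d : R) : 0 < d ->
    \forall x \near x0, \sum_(k <- r) cabs (u x0 k - u x k) < d.
  elim: r d => [|k r IH] d d0.
    by apply: nearW => x; rewrite big_nil.
  have d20 : 0 < d / 2 by rewrite divr_gt0.
  have /cvg_cabsP/(_ _ d20) := uc k.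
  apply: filterS2 (IH _ d20) => x; rewrite big_cons; lra.
have e40 : 0 < e / 4 by rewrite divr_gt0.
have := near_sum (finmap.enum_fset (fset_set F)) _ e40; apply: filterS => x xF.
have sB : csummable (fun k => u x0 k - u x k).
  apply: (@csummable_le _ (fun k => b k + b k)) => [k|].
    by rewrite (le_trans (le_normcD _ _))// normcN lerD.
  by under eq_esum do rewrite EFinD; rewrite esumD// lte_add_pinfty.
rewrite -csumB// -lte_fin; apply: (le_lt_trans (cabs_csum_le _)).
have : (\esum_(k in setT) (cabs (u x0 k - u x k))%:E <
    (e / 4)%:E + (e / 8 + e / 8)%:E)%E.
  rewrite (esumID F); last by move=> k _; rewrite lee_fin cabs_ge0.
  rewrite !setTI.
  have sF : (\esum_(k in F) (cabs (u x0 k - u x k))%:E < (e / 4)%:E)%E.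
    rewrite (esum_fset finF); last by move=> k _; rewrite lee_fin cabs_ge0.
    by rewrite fsbig_finite//= sumEFin lte_fin.
  have sFC : (\esum_(k in ~` F) (cabs (u x0 k - u x k))%:E <=
      (e / 8 + e / 8)%:E)%E.
    apply: (@le_trans _ _ (\esum_(k in ~` F) ((b k)%:E + (b k)%:E))%E).
      apply: le_esum => k _; rewrite -EFinD lee_fin.
      by rewrite (le_trans (le_normcD _ _))// normcN lerD.
    by rewrite esumD// EFinD leeD// ltW.
  apply: lte_leD => //; rewrite ge0_fin_numE ?(le_lt_trans sFC) ?ltry//.
  by apply: esum_ge0 => k _; rewrite lee_fin cabs_ge0.
have: (0 <= \esum_(k in setT) (cabs (u x0 k - u x k))%:E)%E.
  by apply: esum_ge0 => k _; rewrite lee_fin cabs_ge0.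
case: (\esum_(k in setT) _)%E => // q.
by rewrite -[(2 * _)%E]EFinM !lee_fin !lte_fin; lra.
Qed.

End sums.

(** * The unimodular exponential *)

Section expi_theory.
Variable R : realType.
Implicit Types x y : R.

Lemma expiD x y : expi (x + y) = expi x * expi y.
Proof.
rewrite /expi cosD sinD; apply/eqP; rewrite eq_complex /= eqxx/=.
by rewrite addrC.
Qed.

Lemma expi0 : expi (0 : R) = 1.
Proof. by rewrite /expi cos0 sin0. Qed.

Lemma expi_2pi_int (n : int) : expi (2 * pi * n%:~R : R) = 1.
Proof.
have E (m : nat) : expi (2 * pi * m%:R : R) = 1.
  elim: m => [|m IH]; first by rewrite mulr0 expi0.
  rewrite -(natr1 m) mulrDr mulr1 expiD IH mul1r /expi.
  by rewrite mulr_natl cos2pi sin2pi.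
case: n => m; first exact: E.
have := E m.+1; rewrite NegzE mulrNz mulrN => h.
by rewrite -[LHS]mul1r -h -expiD h subrr expi0.
Qed.

Lemma cvg_expi (T : topologicalType) (th : T -> R) (x0 : T) :
  th x @[x --> x0] --> th x0 -> 
  expi (th x) @[x --> x0] --> (expi (th x0) : R[i]^o).
Proof.
move=> thc; apply/cvg_cabsP => e e0.
have e20 : 0 < e / 2 by rewrite divr_gt0.
have := cvg_comp _ _ thc (@continuous_cos R (th x0)).
have := cvg_comp _ _ thc (@continuous_sin R (th x0)).
move=> /cvgrPdist_lt/(_ _ e20) hs /cvgrPdist_lt/(_ _ e20).
apply: filterS2 hs => x hs hc; apply: (le_lt_trans (cabs_le_ReIm _)) => /=.
by rewrite [ltRHS](splitr e) ltrD.
Qed.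

End expi_theory.

Lemma cvg_complexM (R : realType) (T : topologicalType)
    (f g : T -> R[i]^o) (x0 : T) :
  f x @[x --> x0] --> f x0 -> g x @[x --> x0] --> g x0 ->
  ((f x : R[i]) * g x : R[i]^o) @[x --> x0] --> ((f x0 : R[i]) * g x0 : R[i]^o).
Proof. exact: (@cvgM R[i]). Qed.

Lemma cvg_complexMl (R : realType) (T : topologicalType) (w : R[i])
    (g : T -> R[i]^o) (x0 : T) : g x @[x --> x0] --> g x0 ->
  (w * (g x : R[i]) : R[i]^o) @[x --> x0] --> (w * (g x0 : R[i]) : R[i]^o).
Proof.
move=> gc; apply: (@cvg_complexM R T (fun=> w) g).
- exact: (@cvg_cst R[i]^o).
- exact: gc.
Qed.

(** * Continuity and quasi-periodicity of the transform *)

Section lct_theory.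
Variable R : realType.
Implicit Types (Q : 'M[R]_2) (u v : 'cV[R]_2).

Lemma bformDr Q u v v' : bform Q u (v + v') = bform Q u v + bform Q u v'.
Proof. by rewrite /bform mulmxDr mxE. Qed.

Lemma bformE Q u v : bform Q u v =
  (u 0 0 * Q 0 0 + u 1 0 * Q 1 0) * v 0 0 +
  (u 0 0 * Q 0 1 + u 1 0 * Q 1 1) * v 1 0.
Proof.
rewrite /bform !mxE !big_ord_recl big_ord0 addr0.
rewrite !mxE !big_ord_recl !big_ord0 !addr0 !mxE.
rewrite (_ : lift ord0 ord0 = 1)//; exact: val_inj.
Qed.

Lemma cvg_coord n (u0 : 'cV[R]_n) i : 
  (u i 0 : R) @[u --> u0] --> u0 i 0.
Proof. exact: coord_continuous. Qed.

Lemma cvg_bform Q (T : topologicalType) (g h : T -> 'cV[R]_2) x0 :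
  g x @[x --> x0] --> g x0 -> h x @[x --> x0] --> h x0 ->
  bform Q (g x) (h x) @[x --> x0] --> bform Q (g x0) (h x0).
Proof.
move=> gc hc.
have gi i : (g x i 0 : R) @[x --> x0] --> g x0 i 0.
  exact: cvg_comp _ _ gc (@cvg_coord _ (g x0) i).
have hi i : (h x i 0 : R) @[x --> x0] --> h x0 i 0.
  exact: cvg_comp _ _ hc (@cvg_coord _ (h x0) i).
rewrite bformE; under eq_fun do rewrite bformE.
by apply: cvgD; apply: cvgM => //; apply: cvgD; apply: cvgM => //;
  exact: cvg_cst.
Qed.

Lemma cvg_lct_kernel Q Q' Q'' u (T : topologicalType) (g : T -> 'cV[R]_2) x0 :
  g x @[x --> x0] --> g x0 ->
  (expi (pi * bform Q u u - 2 * pi * bform Q' u (g x)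
         + pi * bform Q'' (g x) (g x)) : R[i]^o) @[x --> x0] -->
  (expi (pi * bform Q u u - 2 * pi * bform Q' u (g x0)
         + pi * bform Q'' (g x0) (g x0)) : R[i]^o).
Proof.
move=> gc.
pose th x := pi * bform Q u u - 2 * pi * bform Q' u (g x)
  + pi * bform Q'' (g x) (g x).
apply: (@cvg_expi _ _ th); apply: cvgD; last first.
  by apply: cvgM; [exact: cvg_cst|exact: cvg_bform].
apply: cvgB; first exact: cvg_cst.
apply: cvgM; first exact: cvg_cst.
by apply: (@cvg_bform _ _ (fun=> u)) => //; exact: cvg_cst.
Qed.

(** The kernel is unimodular, so [cabs (s k)] is a majorant independent of the frequency. *)
Lemma ccontinuous_lct (A B D : 'M[R]_2) sq s : csummable s ->
  ccontinuous (lct A B D sq s).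
Proof.
move=> soo xi; rewrite /lct; apply: (@cvg_complexMl R 'cV[R]_2).
pose u x k := s k * expi (pi * bform (invmx B *m A) (zvec R k) (zvec R k) -
  2 * pi * bform (invmx B) (zvec R k) x + pi * bform (D *m invmx B) x x).
apply: (@cvg_csum R 'cV[R]_2 u (fun k => cabs (s k)) xi) => //.
  by move=> x k; rewrite Normc.normcM cabs_expi mulr1.
move=> k; apply: (@cvg_complexMl R 'cV[R]_2).
exact: (@cvg_lct_kernel _ _ _ _ 'cV[R]_2 id).
Qed.

(** [B] cancels its inverse and leaves an integer, which the kernel multiplies by [2 * pi]. *)
Lemma bform_lattice (B : 'M[R]_2) (k n : 'cV[int]_2) : B \in unitmx ->
  bform (invmx B) (zvec R k) (B *m zvec R n) = ((k^T *m n) 0 0)%:~R.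
Proof.
move=> Bu; rewrite /bform mulmxA mulmxKV// !mxE rmorph_sum /=.
by apply: eq_bigr => i _; rewrite !mxE intrM.
Qed.

(** The linear phase changes by multiples of [2 * pi] only, and the change of the quadratic phase in
    the frequency does not involve [k]. The resulting factor is the same for all sequences [s]. *)
Lemma lct_quasiperiodic (A B D : 'M[R]_2) sq s (n : 'cV[int]_2) xi :
  B \in unitmx -> csummable s ->
  let y := xi + B *m zvec R n in
  lct A B D sq s y =
  expi (pi * bform (D *m invmx B) y y - pi * bform (D *m invmx B) xi xi) *
  lct A B D sq s xi.
Proof.
move=> Bu soo y; rewrite /lct [RHS]mulrCA; congr (_ * _).
rewrite -csumZ; last first.
  by apply: le_lt_trans soo; apply: le_esum => k _;
     rewrite lee_fin Normc.normcM cabs_expi mulr1.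
congr csum; apply/funext => k; rewrite [RHS]mulrCA -expiD; congr (_ * _).
have -> : bform (invmx B) (zvec R k) y =
    bform (invmx B) (zvec R k) xi + ((k^T *m n) 0 0)%:~R.
  by rewrite bformDr bform_lattice.
move: (bform _ _ y) (bform _ xi xi) (bform (invmx B) _ _) (bform _ _ _).
(* Multiplying by the exponential of [2 * pi * N], which is 1, cancels the shift of the linear
   phase. *)
move=> qy qx bk ak; have := expi_2pi_int R ((k^T *m n) 0 0).
move: (_%:~R) => N E; rewrite -[LHS]mulr1 -E -expiD; congr expi; ring.
Qed.

End lct_theory.

(** * Boundedness of the inverse *)

Lemma cvg_complexD (R : realType) (T : topologicalType)
    (f g : T -> R[i]^o) (x0 : T) :
  f x @[x --> x0] --> f x0 -> g x @[x --> x0] --> g x0 ->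
  ((f x : R[i]) + g x : R[i]^o) @[x --> x0] --> ((f x0 : R[i]) + g x0 : R[i]^o).
Proof. exact: (@cvgD R[i] R[i]^o). Qed.

Lemma cvg_cabs (R : realType) (T : topologicalType) (f : T -> R[i]^o) (x0 : T) :
  f x @[x --> x0] --> f x0 ->
  (cabs (f x) : R) @[x --> x0] --> (cabs (f x0) : R).
Proof.
move=> fc; apply/cvgrPdist_lt => e e0.
have /cvg_cabsP/(_ _ e0) := fc; apply: filterS => y; apply: le_lt_trans.
have h1 := le_normcD (f y - f x0) (f x0).
have h2 := le_normcD (f x0 - f y) (f y).
have h3 := normcN (f y - f x0).
rewrite opprB in h3; rewrite !subrK in h1 h2.
rewrite ler_norml; apply/andP; split; lra.
Qed.

(** * Continuity of the entries of the inverse matrix *)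

Section ccontinuous_closure.
Variable R : realType.
Implicit Types f g : 'cV[R]_2 -> R[i].

Lemma ccontinuous_cst (w : R[i]) : ccontinuous (fun _ : 'cV[R]_2 => w).
Proof. by move=> x; exact: (@cst_continuous 'cV[R]_2 R[i]^o). Qed.

Lemma ccontinuousM f g : ccontinuous f -> ccontinuous g ->
  ccontinuous (fun x => f x * g x).
Proof.
by move=> fc gc x; apply: (@cvg_complexM R 'cV[R]_2 f g); [exact: fc|exact: gc].
Qed.

Lemma ccontinuousD f g : ccontinuous f -> ccontinuous g ->
  ccontinuous (fun x => f x + g x).
Proof.
by move=> fc gc x; apply: (@cvg_complexD R 'cV[R]_2 f g); [exact: fc|exact: gc].
Qed.

Lemma ccontinuous_sum (I : Type) (r : seq I) (P : pred I)
    (F : I -> 'cV[R]_2 -> R[i]) : (forall i, ccontinuous (F i)) ->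
  ccontinuous (fun x => \sum_(i <- r | P i) F i x).
Proof.
move=> Fc; elim: r => [|i r IH].
  by under eq_fun do rewrite big_nil; exact: ccontinuous_cst.
under eq_fun do rewrite big_cons.
by case: (P i); [apply: ccontinuousD; [exact: Fc|exact: IH]|exact: IH].
Qed.

Lemma ccontinuous_prod (I : Type) (r : seq I) (P : pred I)
    (F : I -> 'cV[R]_2 -> R[i]) : (forall i, ccontinuous (F i)) ->
  ccontinuous (fun x => \prod_(i <- r | P i) F i x).
Proof.
move=> Fc; elim: r => [|i r IH].
  by under eq_fun do rewrite big_nil; exact: ccontinuous_cst.
under eq_fun do rewrite big_cons.
by case: (P i); [apply: ccontinuousM; [exact: Fc|exact: IH]|exact: IH].
Qed.

Lemma ccontinuous_det n (X : 'cV[R]_2 -> 'M[R[i]]_n) :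
  (forall i j, ccontinuous (fun x => X x i j)) ->
  ccontinuous (fun x => \det (X x)).
Proof.
move=> Xc; apply: ccontinuous_sum => s; apply: ccontinuousM.
  exact: ccontinuous_cst.
by apply: ccontinuous_prod => i; exact: Xc.
Qed.

Lemma ccontinuous_adj n (X : 'cV[R]_2 -> 'M[R[i]]_n) i j :
  (forall i j, ccontinuous (fun x => X x i j)) ->
  ccontinuous (fun x => (\adj (X x)) i j).
Proof.
move=> Xc; under eq_fun do rewrite mxE /cofactor.
apply: ccontinuousM; first exact: ccontinuous_cst.
apply: ccontinuous_det => k l; under eq_fun do rewrite !mxE; exact: Xc.
Qed.

Lemma continuous_cabs f : ccontinuous f -> continuous (fun x => cabs (f x)).
Proof. by move=> fc x; apply: (@cvg_cabs R 'cV[R]_2); exact: fc. Qed.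

Lemma invmx_entry n (X : 'M[R[i]]_n) i j : \det X != 0 ->
  invmx X i j = (\det X)^-1 * (\adj X) i j.
Proof. by move=> X0; rewrite /invmx unitmxE unitfE X0 mxE. Qed.

(** Cramer's rule: determinant and adjugate are polynomials in the entries, and taking moduli first
    leaves a division of real functions. *)
Lemma continuous_cabs_invmx n (X : 'cV[R]_2 -> 'M[R[i]]_n) i j :
  (forall i j, ccontinuous (fun x => X x i j)) ->
  (forall x, \det (X x) != 0) ->
  continuous (fun x => cabs (invmx (X x) i j)).
Proof.
move=> Xc X0.
rewrite (_ : (fun x => _) =
    (fun x => (cabs (\det (X x)))^-1 * cabs ((\adj (X x)) i j))); last first.
  by apply/funext => x; rewrite invmx_entry// Normc.normcM Normc.normcV.
move=> x; apply: (@continuousM R 'cV[R]_2 (fun x => (cabs (\det (X x)))^-1)).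
  apply: (@continuousV R 'cV[R]_2 (fun x => cabs (\det (X x)))).
    by apply: contra (X0 x) => /eqP/Normc.eq0_normc ->.
  exact/continuous_cabs/ccontinuous_det.
exact/continuous_cabs/ccontinuous_adj.
Qed.

End ccontinuous_closure.

(** * Bounds for continuous lattice-periodic functions *)

Section periodic.
Variable R : realType.

Lemma cvg_matrix m n (T : topologicalType) (f : T -> 'M[R]_(m, n)) (x0 : T) :
  (forall i j, f x i j @[x --> x0] --> f x0 i j) ->
  f x @[x --> x0] --> f x0.
Proof.
move=> fc; apply/cvg_ballP => e e0.
have : \forall x \near x0, forall i j, ball (f x0 i j) e (f x i j).
  apply: filter_forall => i; apply: filter_forall => j.
  by move/cvg_ballP : (fc i j); exact.
by apply: filterS => x fx; split.
Qed.

(** Row vectors enter because the compact cube of the next proof consists of them. *)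
Lemma cvg_mulmx_tr (B : 'M[R]_2) (T : topologicalType) (g : T -> 'rV[R]_2)
    (x0 : T) :
  g x @[x --> x0] --> g x0 ->
  B *m (g x)^T @[x --> x0] --> B *m (g x0)^T.
Proof.
move=> gc; apply: cvg_matrix => i j.
have gk k : (g x 0 k : R) @[x --> x0] --> g x0 0 k.
  exact: (cvg_comp _ _ gc (@coord_continuous R 1 2 0 k (g x0))).
have E x : (B *m (g x)^T) i j =
    B i ord0 * g x 0 ord0 + B i (lift ord0 ord0) * g x 0 (lift ord0 ord0).
  by rewrite (ord1 j) mxE !big_ord_recl big_ord0 addr0 !mxE.
rewrite E; under eq_fun do rewrite E.
by apply: cvgD; apply: cvgM => //; exact: cvg_cst.
Qed.

(** All values are taken on the image under [B] of the closed unit square, where compactness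
    provides a maximum. *)
Lemma lattice_periodic_bounded (B : 'M[R]_2) (N : 'cV[R]_2 -> R) :
  B \in unitmx -> continuous N ->
  (forall xi n, N (xi + B *m zvec R n) = N xi) ->
  exists K, forall xi, N xi <= K.
Proof.
move=> Bu Nc Nper.
pose I := [set v : 'rV[R]_2 | forall i, `[0, 1]%classic (v ord0 i)].
have cI : compact I.
  apply: (@rV_compact R 2 (fun=> `[0, 1]%classic)) => i.
  exact: segment_compact.
have I0 : I !=set0 by exists 0 => i /=; rewrite mxE in_itv/= lexx ler01.
pose f v := N (B *m v^T : 'cV[R]_2).
have fc : continuous f.
  move=> v; apply: (cvg_comp _ _ (@cvg_mulmx_tr B 'rV[R]_2 id v _)).
    exact: cvg_id.
  exact: Nc.
have [c _ cmax] := EVT_max_rV I0 cI (continuous_subspaceT fc).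
exists (f c) => xi.
have [y ->] : exists y, xi = B *m y.
  by exists (invmx B *m xi); rewrite mulKVmx.
(* The fractional part of [y]: subtracting [floor2 y] is a period of [N] after applying [B]. *)
pose v : 'rV[R]_2 := (y - zvec R (floor2 y))^T.
have -> : N (B *m y) = f v.
  by rewrite /f /v trmxK mulmxBr -[RHS](Nper _ (floor2 y)) subrK.
apply: cmax; rewrite inE => i /=; rewrite !mxE in_itv/=.
have := floor_itv (y i ord0); rewrite intrD => /andP[? ?].
by apply/andP; split; lra.
Qed.

End periodic.

(** * Continuity of the transforms and the determinant criterion *)

Theorem theorem4p3 (R : realType) (A B C D : 'M[R]_2) (sq : R[i])
    (M : 'M[int]_2) (eta : 'I_(absz (\det M)) -> 'cV[int]_2)
    (phi a : 'cV[R]_2 -> R[i])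
    (B_unit : B \in unitmx)
    (ABCD_sympl : symplectic A B C D)
    (sqP : is_sqrt_det_i B sq)
    (M_nonsing : \det M != 0)
    (eta_inj : injective eta)
    (eta_range : range eta = Nset R M^T)
    (eta0 : forall l : 'I_(absz (\det M)), l = 0%N :> nat -> eta l = 0)
    (phi_W0 : wiener0 phi)
    (a_W : wiener a) :
  (forall l j : 'I_(absz (\det M)),
     ccontinuous (lct A B D sq (phi_seq A B sq M a phi (eta l) j))) /\
  (stable_recovery (samp_mx A B D sq M a phi eta) <->
   forall xi : 'cV[R]_2, \det (samp_mx A B D sq M a phi eta xi) != 0).
Proof.
have sums l (j : nat) : csummable (phi_seq A B sq M a phi (eta l) j).
  exact: phi_seq_summable.
have lctc l (j : nat) :
    ccontinuous (lct A B D sq (phi_seq A B sq M a phi (eta l) j)).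
  exact: ccontinuous_lct.
split; first by move=> l j; exact: lctc.
split=> [[Xu _] xi|X0]; first by rewrite -unitfE -unitmxE.
set X := samp_mx A B D sq M a phi eta in X0 *.
split=> [xi|]; first by rewrite unitmxE unitfE.
have Xc i j : ccontinuous (fun xi => X xi i j).
  by under eq_fun do rewrite mxE; exact: lctc.
(* The quasi-periodicity factor depends neither on [eta l] nor on [j], so the whole matrix is scaled
   by one [w]. *)
have Xper xi n :
    exists2 w : R[i], cabs w = 1 & X (xi + B *m zvec R n) = w *: X xi.
  pose y := xi + B *m zvec R n; pose Q := D *m invmx B.
  exists (expi (pi * bform Q y y - pi * bform Q xi xi)); first exact: cabs_expi.
  by apply/matrixP => i j; rewrite !mxE; apply: lct_quasiperiodic.
have bounded i j : exists K, forall xi, cabs (invmx (X xi) i j) <= K.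
  apply: (lattice_periodic_bounded B_unit (continuous_cabs_invmx Xc X0)).
  move=> xi n.
  have Xu : X (xi + B *m zvec R n) \in unitmx by rewrite unitmxE unitfE.
  have [w w1 Xw] := Xper xi n.
  (* The inverse is scaled by the inverse of [w], again of modulus 1. *)
  rewrite Xw invmxZ -?Xw// mxE Normc.normcM Normc.normcV w1 invr1 mul1r//.
have rows i : exists K, forall j xi, cabs (invmx (X xi) i j) <= K j.
  by have [K XK] := choice (bounded i); exists K.
have [K XK] := choice rows.
(* A single constant that exceeds the bound [K i j] of every entry. *)
exists (\sum_i \sum_j `|K i j|) => xi i j.
rewrite normc_def lecR -cabsE; apply: (le_trans (XK i j xi)).
rewrite (bigD1 i)//= (bigD1 j)//= -addrA (le_trans (ler_norm _))// lerDl.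
by rewrite addr_ge0// sumr_ge0// => k _; rewrite sumr_ge0.
Qed.
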